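(* Let $(X,Y,c=\langle\cdot,\cdot\rangle)$ be a dual system, let $G\subset X\times Y$ be non-empty, let $\omega\in Y$, and let $K\subset X$ be non-empty, convex, and $\sigma(X,\Pr_{Y}G\cup\{\omega\})$-compact. Then the following are equivalent: (a) $G^{+}\cap(K\times\{\omega\})\neq\emptyset$, i.e. there is $\alpha\in K$ such that $(\alpha,\omega)$ is monotonically related to $G$; (b) $\forall(x,y)\in X\times Y$, $(\operatorname{conv}c_{G})(x,y)\ge\inf_{\kappa\in K}\langle\kappa,y-\omega\rangle+\langle x,\omega\rangle$; (c) $\forall g\in\operatorname{conv}G$, $\exists\kappa\in K$, $(\operatorname{conv}c_{G}-c)(g)+c(g-(\kappa,\omega))\ge0$. Assume, in addition, that $G$ is monotone. (i) If for every $g\in\operatorname{conv}G$ there is $\kappa\in K$ with $c(g-(\kappa,\omega))\ge0$, then $G^{+}\cap(K\times\{\omega\})\neq\emptyset$. (ii) If $\Pr_{X}G\subset K$, then $G^{+}\cap(K\times\{\omega\})\neq\emptyset$, and in this case, for all $(x,y)\in X\times Y$, $(\operatorname{conv}c_{G})(x,y)\ge\inf_{\kappa\in K}\langle\kappa,y-\omega\rangle+\langle x,\omega\rangle$.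
   Context: A dual system $(X,Y,c=\langle\cdot,\cdot\rangle)$ consists of real vector spaces $X,Y$ and a bilinear form $\langle\cdot,\cdot\rangle:X\times Y\to\mathbb{R}$; no separation is assumed. Put $Z:=X\times Y$, $c(x,y):=\langle x,y\rangle$, and let $\Pr_X,\Pr_Y$ be the projections of $X\times Y$ onto $X$ and $Y$. For $\emptyset\neq B\subset Y$, $\sigma(X,B)$ is the weakest topology on $X$ making all linear forms $x\mapsto\langle x,y\rangle$, $y\in B$, continuous (it need not be Hausdorff; compactness means the finite-subcover property, without Hausdorff). $G\subset Z$ is monotone if $c(g_1-g_2)\ge0$ for all $g_1,g_2\in G$. $G^{+}:=\{z\in Z\mid c(z-g)\ge 0\ \forall g\in G\}$ is the set of points monotonically related to $G$. $c_G:Z\to\mathbb{R}\cup\{+\infty\}$ equals $c$ on $G$ and $+\infty$ off $G$. $\operatorname{conv}c_G:Z\to[-\infty,+\infty]$ is the greatest convex function not exceeding $c_G$, i.e. $(\operatorname{conv}c_G)(z)=\inf\{\sum_{k=1}^n\lambda_k c(g_k)\mid n\ge1,\ g_k\in G,\ \lambda_k\ge0,\ \sum\lambda_k=1,\ \sum\lambda_kg_k=z\}$, with $\inf\emptyset=+\infty$ (the value $-\infty$ is possible). *)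

(* Defs.v *)
From HB Require Import structures.
From mathcomp Require Export all_boot all_order all_algebra.
From mathcomp Require Export all_classical all_reals all_analysis.
Export Order.TTheory GRing.Theory Num.Theory.
Export numFieldNormedType.Exports.

Set Implicit Arguments.
Unset Strict Implicit.
Unset Printing Implicit Defensive.

Local Open Scope classical_set_scope.
Local Open Scope ring_scope.

(* A dual system is a pair of real vector spaces with a bilinear form
   [X -> Y -> R]; no separation is assumed. *)
Notation dual_pairing X Y R := {bilinear X -> Y -> R | *%R & *%R}.

Section DualSystem.
Variables (R : realType) (X Y : lmodType R) (c : dual_pairing X Y R).

Definition coupling (z : X * Y) : R := c z.1 z.2.

(* [set_type B] (into which [B] coerces) indexes the forms [x |-> c x y], so
   this is the coarsest topology on [X] making those with [y] in [B] continuous;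
   it is not Hausdorff in general. *)
Definition sigma_topology (B : set Y) : topologicalType :=
  sup_topology (fun y : B =>
    Topological.class (initial_topology (fun x : X => c x (val y) : R))).

Definition monotone (G : set (X * Y)) : Prop :=
  forall g1 g2, G g1 -> G g2 -> 0 <= coupling (g1 - g2).

(* The set [G^+] of points monotonically related to [G]. *)
Definition monotone_polar (G : set (X * Y)) : set (X * Y) :=
  [set z | forall g, G g -> 0 <= coupling (z - g)].

Definition convex_hull (G : set (X * Y)) : set (X * Y) := smallest (@convex_set R _) G.

(* The convex hull [conv c_G] of the function equal to [coupling] on [G] and to
   [+oo] elsewhere: the infimum, over all ways of writing [z] as a convex
   combination of points of [G], of the combined values of [coupling]. It is
   [+oo] when there is no such combination, and may be [-oo]. *)
Definition conv_coupling (G : set (X * Y)) (z : X * Y) : \bar R :=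
  ereal_inf [set v | exists (n : nat) (l : 'I_n.+1 -> R) (g : 'I_n.+1 -> X * Y),
    [/\ forall k, G (g k), forall k, 0 <= l k, \sum_k l k = 1,
        \sum_k l k *: g k = z & v = (\sum_k l k * coupling (g k))%:E]].

End DualSystem.

(* Main.v *)
(* Writing out [c (g - (k, w))] turns (a) into a system of affine inequalities
   in the point [k] of [K], one for each [g] in [G]:
     [c k (g.2 - w) <= c g - c g.1 w].
   If no [k] solves it, the open sets of points violating one inequality by more
   than some [e > 0] cover [K], so finitely many of them do. Gordan's alternative
   for finitely many convex functions on a convex set then yields one convex
   combination of the inequalities that is violated, by a uniform margin, on all
   of [K], and this contradicts (b). No continuity is needed for the alternative
   itself. With [G] monotone, [c <= conv c_G], so (i) and (ii) reduce to (c). *)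
Require Import Defs.
From mathcomp Require Import ring lra.

Local Open Scope classical_set_scope.
Local Open Scope ring_scope.

(** * Gordan's alternative for convex functions *)

Section Convexity.
Set Implicit Arguments.
Unset Strict Implicit.
Variables (R : realType) (V : lmodType R).
Implicit Types (K : set V) (f g : V -> R).

Lemma convex_setP K x y (t : R) : convex_set K -> K x -> K y ->
  0 <= t <= 1 -> K (t *: x + (1 - t) *: y).
Proof.
move=> Kc Kx Ky /andP[t0 t1].
by have /(_ (mem_set Kx) (mem_set Ky))/set_mem := Kc x y (Itv01 t0 t1).
Qed.

Lemma convex_functionP K f x y (t : R) : convex_function K f -> K x -> K y ->
  0 <= t <= 1 -> f (t *: x + (1 - t) *: y) <= t * f x + (1 - t) * f y.
Proof.
move=> fc Kx Ky /andP[t0 t1].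
exact: (fc (Itv01 t0 t1) x y (mem_set Kx) (mem_set Ky)).
Qed.

Lemma sub_convex_function K L f :
  L `<=` K -> convex_function K f -> convex_function L f.
Proof.
move=> LK fc t x y /set_mem Lx /set_mem Ly.
by apply: fc; apply/mem_set/LK.
Qed.

Lemma convex_function_sum K n (l : 'I_n -> R) (f : 'I_n -> V -> R) :
  (forall i, 0 <= l i) -> (forall i, convex_function K (f i)) ->
  convex_function K (fun x => \sum_i l i * f i x).
Proof.
move=> l0 fc t x y Kx Ky; rewrite convRE !mulr_sumr -big_split /=.
apply: ler_sum => i _; rewrite mulrCA [X in _ + X]mulrCA -mulrDr.
by apply: ler_wpM2l => //; apply: fc.
Qed.

Lemma convex_set_sum n K (l : 'I_n -> R) (x : 'I_n -> V) :
  convex_set K -> (forall i, K (x i)) -> (forall i, 0 <= l i) ->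
  \sum_i l i = 1 -> K (\sum_i l i *: x i).
Proof.
move=> Kc; elim: n l x => [|n IHn] l x Kx l0.
  by rewrite big_ord0 => /esym/eqP; rewrite oner_eq0.
rewrite !big_ord_recl /=; set s := \sum_(i < n) _ => ls.
have sE : 1 - l ord0 = s by rewrite -ls; ring.
have s0 : 0 <= s by apply: sumr_ge0.
(* If the remaining weights add up to 0, they all vanish; otherwise dividing them by [s] makes the
   induction hypothesis applicable. *)
have [s00|s_neq0] := eqVneq s 0.
  rewrite (_ : \sum_(i < n) _ = 0) ?addr0.
    by move: ls; rewrite s00 addr0 => ->; rewrite scale1r.
  apply: big1 => i _; move/eqP: s00; rewrite psumr_eq0 // => /allP/(_ i).
  by rewrite mem_index_enum => /(_ isT)/eqP ->; rewrite scale0r.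
have -> : \sum_(i < n) l (lift ord0 i) *: x (lift ord0 i) =
    (1 - l ord0) *: \sum_(i < n) (l (lift ord0 i) / s) *: x (lift ord0 i).
  rewrite scaler_sumr; apply: eq_bigr => i _.
  by rewrite scalerA sE mulrCA divff // mulr1.
apply: convex_setP => //; last by rewrite l0 -ls lerDl.
apply: IHn => [i|i|]; first exact: Kx.
  by rewrite divr_ge0.
by rewrite -mulr_suml divff.
Qed.

(* The multiplier is the supremum of the slopes [- g b / f b] over [g b < 0];
   convexity along the segments from [f < 0] to [g < 0] bounds them by
   [g a / - f a]. *)
Lemma convex_alternative2 K f g : convex_set K ->
  convex_function K f -> convex_function K g ->
  (forall x, K x -> 0 <= f x \/ 0 <= g x) ->
  exists2 t : R, 0 <= t <= 1 &
    forall x, K x -> 0 <= t * f x + (1 - t) * g x.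
Proof.
move=> Kc fc gc fg.
have [[a [Ka fa]]|/forallNP fpos] := pselect (exists a, K a /\ f a < 0);
  last first.
  exists 1 => [|x Kx]; first by rewrite ler01 lexx.
  rewrite subrr mul0r addr0 mul1r leNgt; apply/negP => fx.
  exact: (fpos x).
have [[b [Kb gb]]|/forallNP gpos] := pselect (exists b, K b /\ g b < 0);
  last first.
  exists 0 => [|x Kx]; first by rewrite ler01 lexx.
  rewrite mul0r add0r subr0 mul1r leNgt; apply/negP => gx.
  exact: (gpos x).
(* If [f y = 0], a small move from [y] towards [a] makes [f] negative. The step [e] brings the bound
   for [g] to [g y / 2], so [g] is negative there too, a contradiction. *)
have f_gt0 y : K y -> g y < 0 -> 0 < f y.
  move=> Ky gy; have [fy|//|fy0] := ltgtP (f y) 0; first by case: (fg y Ky); lra.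
  have ga : 0 <= g a by case: (fg a Ka); lra.
  pose e := - g y / (2 * (g a - g y)).
  have d0 : 0 < 2 * (g a - g y) by lra.
  have e0 : 0 < e by rewrite divr_gt0 //; lra.
  have e1 : e <= 1 by rewrite ler_pdivrMr //; lra.
  have e01 : 0 <= e <= 1 by rewrite ltW.
  have eE : e * (g a - g y) = - g y / 2.
    by rewrite /e; field; lra.
  have := convex_functionP fc Ka Ky e01; rewrite fy0.
  have := convex_functionP gc Ka Ky e01.
  have : e * f a < 0 by rewrite pmulr_rlt0.
  by case: (fg _ (convex_setP Kc Ka Ky e01)); lra.
have cross x y : K x -> f x < 0 -> K y -> g y < 0 ->
    - g y / f y <= g x / - f x.
  move=> Kx fx Ky gy; have fy := f_gt0 _ Ky gy.
  rewrite ler_pdivrMr // mulrAC ler_pdivlMr ?oppr_gt0 // leNgt; apply/negP => h.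
  (* The chord of [f] from [x] to [y] vanishes at this [t], while [h] makes the chord of [g]
     negative there; [f_gt0] forbids this. *)
  pose t := f y / (f y - f x).
  have d0 : 0 < f y - f x by lra.
  have t01 : 0 <= t <= 1.
    by apply/andP; split; rewrite ?divr_ge0 ?ler_pdivrMr //; lra.
  have Kz := convex_setP Kc Kx Ky t01.
  have fz : f (t *: x + (1 - t) *: y) <= 0.
    apply: le_trans (convex_functionP fc Kx Ky t01) _.
    by rewrite (_ : _ + _ = 0) // /t; field; lra.
  have gz : g (t *: x + (1 - t) *: y) < 0.
    apply: le_lt_trans (convex_functionP gc Kx Ky t01) _.
    rewrite (_ : _ + _ = (g x * f y - - g y * - f x) / (f y - f x)).
      by rewrite pmulr_llt0 ?invr_gt0 //; lra.
    by rewrite /t; field; lra.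
  by have := f_gt0 _ Kz gz; lra.
pose S := [set - g y / f y | y in [set y | K y /\ g y < 0]].
have S_sup : has_sup S.
  split; first by exists (- g b / f b), b.
  by exists (g a / - f a) => _ [y [Ky gy] <-]; apply: cross.
pose s := sup S.
have s_ub y : K y -> g y < 0 -> - g y / f y <= s.
  by move=> Ky gy; apply: ub_le_sup; [case: S_sup | exists y].
have s0 : 0 <= s.
  apply: le_trans (s_ub b Kb gb); apply: divr_ge0; first lra.
  exact/ltW/f_gt0.
have sfg x : K x -> 0 <= s * f x + g x.
  move=> Kx; have [fx|fx] := ltP (f x) 0.
    suff : s <= g x / - f x by rewrite ler_pdivlMr; lra.
    apply: ge_sup; first by case: S_sup.
    by move=> _ [y [Ky gy] <-]; apply: cross.
  have [gx|gx] := ltP (g x) 0; last by rewrite addr_ge0 // mulr_ge0.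
  by have := s_ub x Kx gx; rewrite ler_pdivrMr ?f_gt0 //; lra.
have s1 : 0 < 1 + s by lra.
(* This normalizes the multipliers [s] and 1 to total weight 1. *)
exists (s / (1 + s)) => [|x Kx].
  by apply/andP; split; rewrite ?divr_ge0 ?ler_pdivrMr //; lra.
have -> : s / (1 + s) * f x + (1 - s / (1 + s)) * g x =
    (s * f x + g x) / (1 + s).
  by field; lra.
by rewrite divr_ge0 ?sfg // ltW.
Qed.

(** Induction on [n]: on the convex part [L] of [K] where the first function is negative, the others
    satisfy the hypothesis and have a good combination. On all of [K], this combination and the
    first function form a pair for the two-function case. *)
Lemma convex_alternative n K (f : 'I_n.+1 -> V -> R) : convex_set K ->
  (forall i, convex_function K (f i)) ->
  (forall x, K x -> exists i, 0 <= f i x) ->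
  exists l : 'I_n.+1 -> R, [/\ forall i, 0 <= l i, \sum_i l i = 1 &
    forall x, K x -> 0 <= \sum_i l i * f i x].
Proof.
elim: n K f => [|n IHn] K f Kc fc f_ge0.
  exists (fun=> 1); split=> [i||x Kx]; rewrite ?ler01 ?big_ord1 //.
  by have [i] := f_ge0 x Kx; rewrite mul1r ord1.
pose L := K `&` [set x | f ord0 x < 0].
have LK : L `<=` K by move=> ? [].
have Lc : convex_set L.
  move=> x y t /set_mem[Kx fx] /set_mem[Ky fy]; apply/mem_set; split.
    by apply/set_mem/Kc; apply/mem_set.
  apply: le_lt_trans (fc ord0 t x y (mem_set Kx) (mem_set Ky)) _.
  by rewrite -oppr_gt0 convN convR_gt0 // oppr_gt0.
have [|x [Kx fx]|l [l0 l1 lf]] := IHn L (fun i => f (lift ord0 i)) Lc.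
- by move=> i; apply: sub_convex_function (fc _).
- have [i] := f_ge0 x Kx; case: (unliftP ord0 i) => [j ->|->] fi; first by exists j.
  by move: fi; rewrite leNgt fx.
have hc := convex_function_sum l0 (fun i => fc (lift ord0 i)).
have [x Kx|t /andP[t0 t1] tf] := convex_alternative2 Kc (fc ord0) hc.
  have [fx|] := ltP (f ord0 x) 0; last by left.
  by right; apply: lf.
exists (fun i => if unlift ord0 i is Some j then (1 - t) * l j else t); split.
- by move=> i; case: unlift => [j|//]; rewrite mulr_ge0 // subr_ge0.
- rewrite big_ord_recl unlift_none.
  under eq_bigr do rewrite liftK.
  by rewrite -mulr_sumr l1 mulr1 addrC subrK.
move=> x Kx; rewrite big_ord_recl unlift_none.
under eq_bigr do rewrite liftK -mulrA.
by rewrite -mulr_sumr tf.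
Qed.

End Convexity.

(** * The coupling, convex combinations and monotonicity *)

Section DualSystem.
Set Implicit Arguments.
Unset Strict Implicit.
Variables (R : realType) (X Y : lmodType R) (c : dual_pairing X Y R).
Implicit Types (G : set (X * Y)) (K : set X) (z : X * Y) (w : Y).

Lemma pairing_continuous (B : set Y) (y : Y) : B y ->
  continuous (fun x : sigma_topology c B => c x y : R).
Proof.
move=> By x.
have /cvg_sup/(_ (exist _ y (mem_set By))) : (nbhs x) --> x by [].
move=> /(cvg_app (fun x => c x y : R)) h; apply: cvg_trans h _.
exact: (@initial_continuous X R^o (fun x => c x y)).
Qed.

Lemma couplingB u z :
  coupling c (u - z) = coupling c u - c u.1 z.2 - c z.1 u.2 + coupling c z.
Proof. by rewrite /coupling linearBl !linearBr; ring. Qed.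

(** Since the weights add up to 1, the cross terms depend only on the barycentre of the [g i]. *)
Lemma sum_couplingB n (l : 'I_n -> R) (g : 'I_n -> X * Y) u :
  \sum_i l i = 1 -> let z := \sum_i l i *: g i in
  \sum_i l i * coupling c (u - g i) =
  coupling c u - c u.1 z.2 - c z.1 u.2 + \sum_i l i * coupling c (g i).
Proof.
move=> l1 /=; under eq_bigr do rewrite couplingB mulrDr 2!mulrBr.
rewrite big_split /= 2!sumrB -mulr_suml l1 mul1r; congr (_ - _ - _ + _).
  by rewrite linear_sum linear_sumr; apply: eq_bigr => i _; rewrite linearZr_LR.
by rewrite linear_sum linear_sumlz; apply: eq_bigr => i _; rewrite linearZl_LR.
Qed.

Lemma convex_hull_sum G n (l : 'I_n -> R) (g : 'I_n -> X * Y) :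
  (forall i, G (g i)) -> (forall i, 0 <= l i) -> \sum_i l i = 1 ->
  convex_hull G (\sum_i l i *: g i).
Proof.
move=> Gg l0 l1 C [Cc GC]; apply: convex_set_sum => // i.
exact: GC.
Qed.

Lemma convex_hull_fst G K : convex_set K -> fst @` G `<=` K ->
  forall z, convex_hull G z -> K z.1.
Proof.
move=> Kc GK z /(_ [set u | K u.1]); apply; split=> [u v t|u Gu].
  move=> /set_mem Ku /set_mem Kv; apply/mem_set.
  exact/set_mem/(Kc _ _ t (mem_set Ku) (mem_set Kv)).
by apply: GK; exists u.
Qed.

Lemma conv_coupling_le G n (l : 'I_n.+1 -> R) (g : 'I_n.+1 -> X * Y) :
  (forall i, G (g i)) -> (forall i, 0 <= l i) -> \sum_i l i = 1 ->
  (conv_coupling c G (\sum_i l i *: g i)%R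
     <= (\sum_i l i * coupling c (g i))%R%:E)%E.
Proof. by move=> Gg l0 l1; apply: ereal_inf_lbound; exists n, l, g. Qed.

(** The terms [c z] cancel, which turns (c) into the inequality of (b) at a single [k]. The cases of
    infinite [m] are needed because [conv_coupling] may take such values. *)
Lemma sub_coupling_ge0E z (m : \bar R) w k :
  (0 <= (m - (coupling c z)%:E) + (coupling c (z - (k, w)))%:E)%E =
  ((c k (z.2 - w) + c z.1 w)%:E <= m)%E.
Proof.
case: m => [r| |].
- rewrite -EFinB -EFinD !lee_fin couplingB /coupling /= linearBr -[RHS]subr_ge0.
  by congr (_ <= _); ring.
- by rewrite addye // !leey.
- by rewrite addNye !leeNy_eq.
Qed.

Lemma le_conv_coupling_polar G z k w : monotone_polar c G (k, w) ->
  ((c k (z.2 - w) + c z.1 w)%:E <= conv_coupling c G z)%E.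
Proof.
move=> Gkw; apply/ereal_infP => _ [n [l [g [Gg l0 l1 zE ->]]]].
rewrite lee_fin -subr_ge0.
have -> : \sum_i l i * coupling c (g i) -
    (c k (z.2 - w) + c z.1 w) = \sum_i l i * coupling c ((k, w) - g i).
  by rewrite sum_couplingB // zE /coupling /= linearBr; ring.
by apply: sumr_ge0 => i _; rewrite mulr_ge0 // Gkw.
Qed.

(** Averaging [coupling c (g j - g i)] over both indices gives twice the gap between the averaged
    coupling and the coupling of the barycentre. *)
Lemma monotone_coupling_le_conv G z : monotone c G ->
  ((coupling c z)%:E <= conv_coupling c G z)%E.
Proof.
move=> Gm; apply/ereal_infP => _ [n [l [g [Gg l0 l1 zE ->]]]].
rewrite lee_fin; set M := \sum_i l i * _.
have : 0 <= \sum_j l j * \sum_i l i * coupling c (g j - g i).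
  apply: sumr_ge0 => j _; rewrite mulr_ge0 // sumr_ge0 // => i _.
  by rewrite mulr_ge0 // Gm.
have -> : \sum_j l j * \sum_i l i * coupling c (g j - g i) =
    2 * (M - coupling c z).
  under eq_bigr => j _.
    rewrite sum_couplingB // zE -/M.
    rewrite (_ : _ + M = coupling c (z - g j) + (M - coupling c z)); last first.
      by rewrite couplingB; ring.
    rewrite mulrDr; over.
  rewrite big_split /= -mulr_suml l1 sum_couplingB // zE -/M /coupling; ring.
by lra.
Qed.

(** * Compactness and existence of a monotonically related point *)

Lemma open_pairing_gt (B : set Y) y w (r : R) : B y -> B w ->
  @open (sigma_topology c B) [set x | r < c x (y - w)].
Proof.
move=> By Bw; rewrite (_ : [set x | _] =
    (fun x : sigma_topology c B => c x y - c x w : R) @^-1` [set s | r < s]).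
  apply: open_comp; last exact: open_gt.
  move=> x _.
  exact: cvgB (@pairing_continuous B y By x) (@pairing_continuous B w Bw x).
by apply/seteqP; split=> x /=; rewrite linearBr.
Qed.

Lemma convex_function_pairing K y (r : R) :
  convex_function K (fun x => c x y - r).
Proof.
move=> t u v _ _; rewrite convRE linearDl !linearZl_LR /= lerBlDr.
by rewrite !mulrBr addrACA -opprD -mulrDl unstable.add_onemK mul1r subrK.
Qed.

(** The last hypothesis is (b) for each convex combination, with a slack [e] because the infimum
    over [K] need not be attained. *)
Lemma monotone_polar_neq0 G K w : K !=set0 -> convex_set K ->
  @cover_compact (sigma_topology c ((snd @` G) `|` [set w])) K ->
  (forall n (l : 'I_n.+1 -> R) (g : 'I_n.+1 -> X * Y) (e : R),
    (forall i, G (g i)) -> (forall i, 0 <= l i) -> \sum_i l i = 1 -> 0 < e ->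
    let z := \sum_i l i *: g i in
    exists2 k, K k &
      c k (z.2 - w) + c z.1 w < \sum_i l i * coupling c (g i) + e) ->
  monotone_polar c G `&` (K `*` [set w]) !=set0.
Proof.
move=> [k0 Kk0] Kc Kcpt Hcomb; apply: contrapT => nex.
(* An index is a point of [G] with a margin; [F p] collects the points violating the inequality of
   [p.1] by more than [p.2]. *)
pose D : set ((X * Y) * R) := [set p | G p.1 /\ 0 < p.2].
pose r (p : (X * Y) * R) := coupling c p.1 - c p.1.1 w + p.2.
pose F p : set X := [set x | r p < c x (p.1.2 - w)].
have [p [Gp _]|x Kx|D' D'D KF] := Kcpt _ D F.
- by apply: open_pairing_gt; [left; exists p.1 | right].
- have [g [Gg gx]] : exists g, G g /\ coupling c ((x, w) - g) < 0.
    apply: contrapT => /forallNP nx; apply: nex; exists (x, w); split=> // g Gg.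
    by rewrite /= leNgt; apply/negP => gx; apply: (nx g).
  exists (g, - coupling c ((x, w) - g) / 2); first by split=> //=; lra.
  move: gx; rewrite /F /r /= couplingB /coupling /= linearBr; lra.
pose s := finmap.enum_fset D'.
(* The subcover has a member because it covers [k0]. *)
have [n sn] : exists n, size s = n.+1.
  have [p /= ps _] := KF k0 Kk0.
  exists (size s).-1; rewrite prednK // -has_predT.
  by apply/hasP; exists p.
pose p i := nth (0, 0) s (i : 'I_n.+1).
have Dp i : D (p i) by apply/set_mem/D'D/mem_nth; rewrite sn.
have [|x Kx|l [l0 l1 lf]] := convex_alternative
    (f := fun i x => c x ((p i).1.2 - w) - r (p i)) Kc.
- by move=> i; apply: convex_function_pairing.
- have [q /= qs qx] := KF x Kx.
  have iq : (index q s < n.+1)%N by rewrite -sn index_mem.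
  by exists (Ordinal iq); rewrite /p nth_index // subr_ge0 ltW.
have e_ge0 i : 0 <= l i * (p i).2 by rewrite mulr_ge0 // ltW; case: (Dp i).
(* The averaged margin serves as the slack; it is positive since the weights cannot all vanish. *)
have e0 : 0 < \sum_i l i * (p i).2.
  rewrite lt0r sumr_ge0 // andbT psumr_eq0 //; apply/negP => /allP le0.
  move: l1; rewrite big1 => [/esym/eqP|i _]; first by rewrite oner_eq0.
  have /eqP := le0 i (mem_index_enum i); case: (Dp i) => _ pi0.
  by move/eqP; rewrite mulf_eq0 (gt_eqF pi0) orbF => /eqP.
have [i|k Kk] := Hcomb n l (fun i => (p i).1) _ _ l0 l1 e0; first by case: (Dp i).
have := lf k Kk; set z := \sum_i l i *: _.
have -> : \sum_i l i * (c k ((p i).1.2 - w) - r (p i)) =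
    c k (z.2 - w) + c z.1 w -
    (\sum_i l i * coupling c (p i).1 + \sum_i l i * (p i).2).
  under eq_bigr => i _.
    rewrite (_ : _ * _ = l i * - coupling c ((k, w) - (p i).1) - l i * (p i).2).
      over.
    by rewrite /r couplingB /coupling /= [c k (_ - _)]linearBr; ring.
  rewrite sumrB; under eq_bigr do rewrite mulrN.
  rewrite sumrN sum_couplingB // -/z /coupling /= linearBr; ring.
by rewrite subr_ge0 => /le_lt_trans h /h; rewrite ltxx.
Qed.

End DualSystem.

Theorem theorem13 (R : realType) (X Y : lmodType R) (c : dual_pairing X Y R)
    (G : set (X * Y)) (w : Y) (K : set X)
    (G_neq0 : G !=set0) (K_neq0 : K !=set0) (K_convex : convex_set K)
    (K_compact :
      @cover_compact (sigma_topology c ((snd @` G) `|` [set w])) K) :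
  let a := monotone_polar c G `&` (K `*` [set w]) !=set0 in
  let b := forall (x : X) (y : Y),
    (ereal_inf [set (c k (y - w))%:E | k in K] + (c x w)%:E
       <= conv_coupling c G (x, y))%E in
  let c' := forall g : X * Y, convex_hull G g ->
    exists2 k, K k &
      (0 <= (conv_coupling c G g - (coupling c g)%:E)
             + (coupling c (g - (k, w)))%:E)%E in
  ((a <-> b) /\ (a <-> c') /\ (b <-> c')) /\
  (monotone c G ->
     ((forall g : X * Y, convex_hull G g ->
         exists2 k, K k & 0 <= coupling c (g - (k, w))) -> a) /\
     (fst @` G `<=` K -> a /\ b)).
Proof.
move=> a b c'.
have ac' : a -> c'.
    move=> [[k v] [Gkw [/= Kk vw]]] z _; exists k => //.
  by rewrite sub_coupling_ge0E; apply: le_conv_coupling_polar; rewrite -vw.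
have c'b : c' -> b.
  move=> Hc' x y; apply/ereal_infP => _ [n [l [g [Gg l0 l1 gE ->]]]].
  (* Each combination entering the infimum already places [(x, y)] in the hull, so (c) applies. *)
  have := convex_hull_sum Gg l0 l1; rewrite gE => /Hc'[k Kk].
  rewrite sub_coupling_ge0E /= => kg.
  apply: (@le_trans _ _ (c k (y - w) + c x w)%:E).
    by rewrite EFinD leeD2r //; apply: ereal_inf_lbound; exists k.
  by apply: le_trans kg _; rewrite -gE; apply: conv_coupling_le.
have ba : b -> a.
  move=> Hb; apply: monotone_polar_neq0 => // n l g e Gg l0 l1 e0 z.
  (* The slack [e] makes (b) strict, so some point of [K] lies below the bound. *)
  have : (ereal_inf [set (c k (z.2 - w))%:E | k in K] <
      (\sum_i l i * coupling c (g i) + e - c z.1 w)%:E)%E.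
    rewrite EFinB lteBrDr //.
    apply: (le_lt_trans (Hb _ _)); rewrite -surjective_pairing.
    apply: le_lt_trans (conv_coupling_le _ Gg l0 l1) _.
    by rewrite lte_fin ltrDl.
  move=> /ereal_inf_lt[_ [k Kk <-]]; rewrite lte_fin => kz.
  by exists k => //; lra.
have i : monotone c G -> (forall g : X * Y, convex_hull G g ->
    exists2 k, K k & 0 <= coupling c (g - (k, w))) -> a.
  move=> Gm HG; apply/ba/c'b => z /HG[k Kk kz]; exists k => //.
  by rewrite adde_ge0 ?lee_fin // sube_ge0 // monotone_coupling_le_conv.
split; first by split; [|split]; split; auto.
move=> Gm; split=> [|GK]; first exact: i.
suff Ha : a by split; auto.
(* With [z.1] as the point of [K], the first component of the difference is 0, and so is its
   coupling. *)
apply: i => // z Gz; exists z.1; first exact: convex_hull_fst Gz.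
by rewrite /coupling /= subrr linear0l.
Qed.
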